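(* Let $(V,\top)$ be a locality vector space, $W\subseteq V$ a linear subspace of $V$ and $\pi:V\to V/W$ the quotient map. Then the following statements are equivalent: 1. $(V/W,\overline{\top})$ is a locality vector space; 2. for any $u\in V$, the set $H_u:=\bigcup_{u'\in[u]}\pi(P^\top(u'))\subset V/W$ is a commutative group (for the operation $+$ induced on the quotient space by the operation $+$ on $V$); 3. for any $u\in V$, the set $H_u$ is a commutative semigroup (for the same operation).
   Context: The ground field $\mathbb{K}$ is $\mathbb{R}$ or $\mathbb{C}$. A locality vector space is a vector space $V$ with a symmetric relation $\top\subset V\times V$ containing $(0,0)$ such that for every subset $U\subset V$ the polar set $U^\top=\{x\in V: x\top u\ \forall u\in U\}$ is a linear subspace. $P^\top(u'):=\{u'\}^\top$. For $u\in V$, $[u]=u+W\subset V$ is its class. The quotient locality $\overline\top$ on $V/W$ is defined by: $[u]\,\overline\top\,[v]$ iff there exist $u'\in[u]$ and $v'\in[v]$ with $u'\top v'$. *)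

(* Defs.v *)
From HB Require Import structures.
From mathcomp Require Import all_boot all_order all_algebra.
From mathcomp Require Import all_classical all_reals.
From mathcomp Require Import complex.

Set Implicit Arguments.
Unset Strict Implicit.
Unset Printing Implicit Defensive.

Import GRing.Theory.
Local Open Scope classical_set_scope.
Local Open Scope ring_scope.
Local Open Scope quotient_scope.

Variant real_or_complex (R : realType) : fieldType -> Prop :=
| IsReal : real_or_complex R R
| IsComplex : real_or_complex R R[i].

Definition linear_subspace (K : fieldType) (V : lmodType K) (S : set V) : Prop :=
  GRing.submod_closed [in S].

(* The library only has quotients of Z-modules (no scalar multiplication on
   [Quotient.quot]), so the vector space structure on V / W is added here. *)
Section QuotientSpace.
Variables (K : fieldType) (V : lmodType K) (W : set V).

Definition subspace_pred (hW : linear_subspace W) : {pred V} := [in W].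

Variable hW : linear_subspace W.

HB.instance Definition _ := GRing.isZmodClosed.Build V (subspace_pred hW)
  (GRing.submod_closedB hW).

Definition quotv : Type := Quotient.quot (subspace_pred hW).

HB.instance Definition _ := ZmodQuotient.on quotv.

Definition scaleq (a : K) := lift_op1 quotv ( *:%R a).

Lemma pi_scale (a : K) : {morph \pi_quotv : v / a *: v >-> scaleq a v}.
Proof.
have [W0 Wlin] : linear_subspace W := hW.
move=> v; unlock scaleq.
have : \pi_quotv v = \pi_quotv (repr (\pi_quotv v)) by rewrite reprK.
move: (repr _) => u /eqP vu; apply/eqP; move: vu.
rewrite !piE /Quotient.equiv -scalerBr => Wvu.
by have := Wlin a _ _ Wvu W0; rewrite addr0.
Qed.
Canonical pi_scale_morph a := PiMorph1 (pi_scale a).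

Lemma scaleqA a b x : scaleq a (scaleq b x) = scaleq (a * b) x.
Proof. by rewrite -[x]reprK !piE scalerA. Qed.

Lemma scale1q : left_id 1 scaleq.
Proof. by move=> x; rewrite -[x]reprK !piE scale1r. Qed.

Lemma scaleqDr : right_distributive scaleq +%R.
Proof. by move=> a x y; rewrite -[x]reprK -[y]reprK !piE scalerDr. Qed.

Lemma scaleqDl x : {morph scaleq^~ x : a b / a + b}.
Proof. by move=> a b; rewrite -[x]reprK !piE scalerDl. Qed.

HB.instance Definition _ := GRing.Zmodule_isLmodule.Build K quotv
  scaleqA scale1q scaleqDr scaleqDl.

End QuotientSpace.

Section Locality.
Variables (K : fieldType) (V : lmodType K) (top : V -> V -> Prop).

Definition polar (U : set V) : set V := [set x | forall u, U u -> top x u].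

Record locality_space : Prop := LocalitySpace {
  locality_sym : forall x y, top x y -> top y x;
  locality0 : top 0 0;
  locality_polar : forall U : set V, linear_subspace (polar U)
}.

End Locality.

Section QuotientLocality.
Variables (K : fieldType) (V : lmodType K) (top : V -> V -> Prop).
Variables (W : set V) (hW : linear_subspace W).

Definition coset (u : V) : set V := [set u + w | w in W].

Definition quot_top (a b : quotv hW) : Prop :=
  exists u v, [/\ a = \pi u, b = \pi v &
    exists u' v', [/\ coset u u', coset v v' & top u' v']].

Definition Hset (u : V) : set (quotv hW) :=
  \bigcup_(u' in coset u) (\pi_(quotv hW) @` polar top [set u']).

End QuotientLocality.
Arguments quot_top [K V] top [W] hW a b.
Arguments Hset [K V] top [W] hW u _.

Section SubsetAlgebra.
Variables (T : Type) (op : T -> T -> T) (H : set T).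

Record comm_semigroup_on : Prop := CommSemigroupOn {
  op_closed : forall x y, H x -> H y -> H (op x y);
  op_assoc : forall x y z, H x -> H y -> H z -> op x (op y z) = op (op x y) z;
  op_comm : forall x y, H x -> H y -> op x y = op y x
}.

Definition comm_group_on : Prop :=
  comm_semigroup_on /\
  exists e, [/\ H e, (forall x, H x -> op e x = x) &
    forall x, H x -> exists2 y, H y & op y x = e].

End SubsetAlgebra.

(* Main.v *)
Require Import Defs.
From mathcomp Require Import all_boot all_order all_algebra.
From mathcomp Require Import all_classical all_reals.
From mathcomp Require Import complex.

(** The three statements are linked by one observation: [Hset top hW u] is
    exactly the polar of the singleton containing the class of [u], for the
    quotient relation ([HsetE]).  If the quotient is a locality space, each
    such polar is a linear subspace, and its additive structure is a
    commutative group.  Conversely, in [V] every polar is stable under scaling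
    and contains [0], and both properties pass to the quotient relation
    whatever the subspace [W] ([quot_top_scale], [quot_top_0l]).  The only thing that
    can fail in the quotient is stability under addition, because two elements
    of [Hset top hW u] may be related to different representatives of the class
    of [u]; the semigroup hypothesis supplies precisely this.  An arbitrary
    polar is the intersection of polars of singletons, so controlling the latter
    is enough. *)

Set Implicit Arguments.
Unset Strict Implicit.
Unset Printing Implicit Defensive.

Import GRing.Theory.
Local Open Scope classical_set_scope.
Local Open Scope ring_scope.
Local Open Scope quotient_scope.

Lemma linear_subspaceP (K : fieldType) (V : lmodType K) (S : set V) :
  linear_subspace S <->
  S 0 /\ forall (a : K) (x y : V), S x -> S y -> S (a *: x + y).
Proof.
split=> -[S0 Slin]; split; rewrite ?inE // in S0 *.
  by move=> a x y Sx Sy; have := Slin a x y; rewrite !inE; apply.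
by move=> a x y; rewrite !inE; apply: Slin.
Qed.

Lemma linear_subspace_comm_group (K : fieldType) (V : lmodType K) (S : set V) :
  linear_subspace S -> comm_group_on +%R S.
Proof.
move=> /linear_subspaceP[S0 Slin]; split.
  split=> [x y Sx Sy|x y z _ _ _|x y _ _].
  - by rewrite -[x]scale1r; apply: Slin.
  - exact: addrA.
  - exact: addrC.
exists 0; split=> // [x _|x Sx]; first exact: add0r.
exists (- x); last exact: addNr.
by rewrite -scaleN1r -[_ *: _]addr0; apply: Slin.
Qed.

Section QuotientRelation.
Variables (K : fieldType) (V : lmodType K) (top : V -> V -> Prop).
Variables (W : set V) (hW : linear_subspace W).
Local Notation piW := (\pi_(quotv hW)).

Lemma eq_pi_coset (u v : V) : piW v = piW u <-> coset W u v.
Proof.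
have eqE : (piW v == piW u) = (v - u \in W).
  by rewrite !piE.
split=> [/eqP|[w Ww uwv]].
  by rewrite eqE inE => Wvu; exists (v - u); rewrite // addrC subrK.
by apply/eqP; rewrite eqE -uwv addrAC subrr add0r inE.
Qed.

(** Membership in a coset is equality of classes, so the two layers of
    representatives in [quot_top] collapse into one. *)
Lemma quot_topP (a b : quotv hW) :
  quot_top top hW a b <-> exists x y, [/\ a = piW x, b = piW y & top x y].
Proof.
split=> [[u [v [-> -> [x [y [/eq_pi_coset xu /eq_pi_coset yv xy]]]]]]|].
  by exists x, y; split.
move=> [x [y [-> -> xy]]]; exists x, y; split=> //.
by exists x, y; split=> //; apply/eq_pi_coset.
Qed.

Lemma HsetE (u : V) :
  Hset top hW u = polar (quot_top top hW) [set piW u].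
Proof.
apply/seteqP; split=> a /=.
  move=> [y /eq_pi_coset yu [x xy <-]] _ ->; apply/quot_topP.
  by exists x, y; split=> //; apply: xy.
move=> /(_ _ erefl)/quot_topP[x [y [-> /esym/eq_pi_coset yu xy]]].
by exists y => //; exists x => // _ ->.
Qed.

Hypothesis top_loc : locality_space top.

Lemma quot_top_0l (b : quotv hW) : quot_top top hW 0 b.
Proof.
apply/quot_topP; exists 0, (repr b); split; rewrite ?reprK ?raddf0 //.
have /linear_subspaceP[+ _] := locality_polar top_loc [set repr b].
exact.
Qed.

Lemma quot_top_scale (k : K) (a b : quotv hW) :
  quot_top top hW a b -> quot_top top hW (k *: a) b.
Proof.
move=> /quot_topP[x [y [-> -> xy]]]; apply/quot_topP.
exists (k *: x), y; split=> //; first exact/esym/pi_scale.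
have /linear_subspaceP[P0 Plin] := locality_polar top_loc [set y].
by have := Plin k x 0 _ P0; rewrite addr0; apply=> // _ ->.
Qed.

Lemma quot_top_sym (a b : quotv hW) :
  quot_top top hW a b -> quot_top top hW b a.
Proof.
move=> /quot_topP[x [y [-> -> xy]]]; apply/quot_topP.
by exists y, x; split=> //; apply: locality_sym xy.
Qed.

(** The hypothesis concerns polars of single classes; it reaches the polar of a
    set [U] because that polar is the intersection of the polars of the points
    of [U]. *)
Lemma quot_locality :
  (forall (u : V) a b, Hset top hW u a -> Hset top hW u b ->
    Hset top hW u (a + b)) ->
  locality_space (quot_top top hW).
Proof.
move=> Hadd; split=> [|//|U]; [exact: quot_top_sym|exact: quot_top_0l|].
apply/linear_subspaceP; split=> [c _|k a b Ua Ub c Uc]; first exact: quot_top_0l.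
have := Hadd (repr c) (k *: a) b; rewrite HsetE reprK.
by apply=> // _ ->; [apply: quot_top_scale; apply: Ua|apply: Ub].
Qed.

End QuotientRelation.

Theorem theorem5p3 (R : realType) (K : fieldType) (hK : real_or_complex R K)
    (V : lmodType K) (top : V -> V -> Prop) (hV : locality_space top)
    (W : set V) (hW : linear_subspace W) :
  [<-> locality_space (quot_top top hW);
       forall u : V, comm_group_on +%R (Hset top hW u);
       forall u : V, comm_semigroup_on +%R (Hset top hW u)].
Proof.
tfae=> [Qloc u|Hgrp u|Hsemi].
- by rewrite HsetE; apply: linear_subspace_comm_group; apply: locality_polar.
- by case: (Hgrp u).
- by apply: quot_locality => // u; apply: op_closed (Hsemi u).
Qed.
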